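(* Let $\langle \mathcal{S}, \mathcal{A}, P, R, \gamma\rangle$ be a Markov decision process with finite state space $\mathcal{S}$, finite action space $\mathcal{A}$, transition probability matrices $\mathbf{P}^a \in \mathbb{R}^{|\mathcal{S}|\times|\mathcal{S}|}$ ($a \in \mathcal{A}$), state-dependent reward vector $\mathbf{R} = (R(s))_{s\in\mathcal{S}} \in \mathbb{R}^{|\mathcal{S}|}$, and discount factor $\gamma \in (0,1)$. Let $\pi$ be a stationary deterministic policy with policy matrix $\mathbf{\Pi} \in \{0,1\}^{|\mathcal{S}|\times|\mathcal{A}|}$, and let $\mathbf{P}^\pi$ be the transition probability matrix under $\pi$. Then $\pi$ is optimal if and only if its policy matrix $\mathbf{\Pi}$ satisfies $$(\mathbf{P}^{\pi} - \mathbf{P}^a)(\mathbf{I} - \gamma \mathbf{P}^{\pi})^{-1}\mathbf{R} \succeq \mathbf{0} \quad \text{for all } a \in \mathcal{A},$$ $$\mathbf{P}^{\pi}(s) = \sum_{a\in\mathcal{A}} \mathbf{P}^a(s)\,\mathbf{\Pi}(s,a) \quad \text{for all } s \in \mathcal{S}.$$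
   Context: The entry $P^a_{ij}$ of $\mathbf{P}^a$ is the probability of moving from state $i$ to state $j$ upon taking action $a$, so each $\mathbf{P}^a$ is row-stochastic. For a matrix $M$ indexed by states, $M(s)$ denotes its row indexed by $s$. The symbol $\succeq$ denotes the componentwise (non-strict) inequality between vectors, $\mathbf{0}$ is the zero vector in $\mathbb{R}^{|\mathcal{S}|}$, and $\mathbf{I}$ is the identity matrix. The reward depends only on the current state, $R:\mathcal{S}\to\mathbb{R}$. A (stationary) policy $\pi$ assigns to each state $s$ a probability distribution $\pi(\cdot|s)$ on $\mathcal{A}$, where $\pi(a|s)$ is the probability of taking action $a$ in state $s$. It is deterministic if for each $s$ there is an action $a$ with $\pi(a|s)=1$. The policy matrix of $\pi$ is the $|\mathcal{S}|\times|\mathcal{A}|$ matrix $\mathbf{\Pi}$ with $\mathbf{\Pi}(s,a) = \pi(a|s)$; for deterministic $\pi$ this is $1$ if $\pi(a|s)=1$ and $0$ otherwise. For a deterministic policy $\pi$, the transition probability matrix $\mathbf{P}^\pi$ under $\pi$ is the $|\mathcal{S}|\times|\mathcal{S}|$ matrix whose row in state $s$ is $\mathbf{P}^\pi(s) = \mathbf{P}^{a_1}(s)$, where $a_1$ is the action with $\pi(a_1|s)=1$. Optimality is in the usual infinite-horizon discounted sense: the value of $\pi$ from state $s$ is $V^\pi(s) = \mathbb{E}\bigl[\sum_{t\ge 0}\gamma^t R(s_t) \mid s_0 = s, \pi\bigr]$, and $\pi$ is optimal if $V^\pi(s) \ge V^{\pi'}(s)$ for every state $s$ and every policy $\pi'$.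 *)

(* Defs.v *)
From HB Require Import structures.
From mathcomp Require Import all_boot all_order all_algebra.
From mathcomp Require Import all_classical all_reals all_analysis.

Set Implicit Arguments.
Unset Strict Implicit.
Unset Printing Implicit Defensive.

Import Order.TTheory GRing.Theory Num.Theory.
Import numFieldNormedType.Exports.

Local Open Scope classical_set_scope.
Local Open Scope ring_scope.

(* States and actions are numbered: the state space is 'I_nS, the action      *)
(* space 'I_nA. [trans M a s s'] is the probability of moving from s to s'    *)
(* when action a is taken.                                                    *)
Record mdp (K : realType) (nS nA : nat) := MDP {
  trans : 'I_nA -> 'M[K]_nS;
  reward : 'cV[K]_nS;
  discount : K;
  trans_ge0 : forall a s s', 0 <= trans a s s';
  trans_sum1 : forall a s, \sum_s' trans a s s' = 1;
  discount_gt0 : 0 < discount;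
  discount_lt1 : discount < 1 }.

(* Stationary, possibly randomized: [pi s a] is the probability pi(a|s).      *)
Record policy (K : realType) (nS nA : nat) := Policy {
  policy_fun :> 'I_nS -> 'I_nA -> K;
  policy_ge0 : forall s a, 0 <= policy_fun s a;
  policy_sum1 : forall s, \sum_a policy_fun s a = 1 }.

Section Definitions.
Context {K : realType} {nS nA : nat}.
Implicit Types (M : mdp K nS nA) (pi : policy K nS nA).

Definition policy_mx pi : 'M[K]_(nS, nA) := \matrix_(s, a) pi s a.

Definition deterministic pi : Prop := forall s, exists a, pi s a == 1.

Definition det_action pi (hpi : deterministic pi) (s : 'I_nS) : 'I_nA :=
  xchoose (hpi s).

Definition det_trans M pi (hpi : deterministic pi) : 'M[K]_nS :=
  \matrix_(s < nS) row s (trans M (det_action hpi s)).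

(* Probability that the decision process started in s and driven by pi        *)
(* follows x 0, b 0, x 1, b 1, ..., b T.-1, x T (states x, actions b).        *)
Definition path_prob M pi (s : 'I_nS)
    (x : nat -> 'I_nS) (b : nat -> 'I_nA) (T : nat) : K :=
  (x 0%N == s)%:R *
  \prod_(t < T) (pi (x t) (b t) * trans M (b t) (x t) (x t.+1)).

(* The random states X and actions A on the probability space (W, P) form the *)
(* decision process started in s and driven by pi. Measurability is stated on *)
(* the fibres, which is enough since the state and action spaces are finite.  *)
Definition is_run M pi (s : 'I_nS) (d : measure_display)
    (W : measurableType d) (P : probability W K)
    (X : nat -> W -> 'I_nS) (A : nat -> W -> 'I_nA) : Prop :=
  [/\ forall t x, measurable (X t @^-1` [set x]),
      forall t a, measurable (A t @^-1` [set a]) &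
      forall x b T,
        P [set w | (forall t, (t <= T)%N -> X t w = x t) /\
                   (forall t, (t < T)%N -> A t w = b t)] =
        (path_prob M pi s x b T)%:E].

Definition discounted_return M (W : Type) (X : nat -> W -> 'I_nS) (w : W) : K :=
  limn (series (fun t => discount M ^+ t * reward M (X t w) ord0)).

(* The expected discounted return from s. The law of a run is determined by M,*)
(* pi and s, and runs exist (already on [0, 1] with Lebesgue measure), so the *)
(* set below is a singleton and the default 0 is never used.                  *)
Definition value M pi (s : 'I_nS) : K :=
  xget 0 [set v | exists (d : measure_display) (W : measurableType d)
      (P : probability W K) (X : nat -> W -> 'I_nS) (A : nat -> W -> 'I_nA),
    is_run M pi s P X A /\ 'E_P[discounted_return M X]%E = v%:E].

Definition optimal M pi : Prop :=
  forall (pi' : policy K nS nA) (s : 'I_nS), value M pi' s <= value M pi s.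

End Definitions.

(* Main.v *)
(* The value of a policy with averaged transition matrix P is the solution V of
   V = R + g P V. If V' is the value of another policy, with matrix P', then
   D = V - V' satisfies D - g P' D = g (P - P') V, and by the minimum principle
   for the stochastic matrix P' a nonnegative right-hand side forces D >= 0.
   Hence the inequalities imply optimality; conversely, a violated inequality
   at (a, s) makes the policy that deviates from pi only at s, by playing a,
   strictly better.

   The value itself is defined through runs on a probability space. Runs exist,
   since a single uniform variable can be subdivided again and again to draw
   the successive actions and states, and the expected return of any run is V,
   by dominated convergence of its partial sums. *)
Require Import Defs.
From HB Require Import structures.
From mathcomp Require Import all_boot all_order all_algebra.
From mathcomp Require Import all_classical all_reals all_analysis.
From mathcomp Require Import measurable_realfun.
From mathcomp Require Import ring lra.
Set Implicit Arguments.
Unset Strict Implicit.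
Unset Printing Implicit Defensive.
Import Order.TTheory GRing.Theory Num.Theory.
Import numFieldNormedType.Exports.
Local Open Scope classical_set_scope.
Local Open Scope ring_scope.

(** * Stochastic matrices and the discounted resolvent *)

Definition stochastic (K : realType) n (Q : 'M[K]_n) : Prop :=
  (forall i j, 0 <= Q i j) /\ (forall i, \sum_j Q i j = 1).

Section Stochastic.
Context {K : realType} {n : nat} (Q : 'M[K]_n) (g : K).
Hypotheses (stoQ : stochastic Q) (g_ge0 : 0 <= g) (g_lt1 : g < 1).
Implicit Types u : 'cV[K]_n.

Lemma stochastic_mul_ge u c :
  (forall s, c <= u s ord0) -> forall s, c <= (Q *m u) s ord0.
Proof.
move=> cu s; rewrite mxE -[c]mul1r -(stoQ.2 s) mulr_suml.
by apply: ler_sum => j _; rewrite ler_wpM2l ?stoQ.1.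
Qed.

Lemma stochastic_mul_norm u c :
  (forall s, `|u s ord0| <= c) -> forall s, `|(Q *m u) s ord0| <= c.
Proof.
move=> uc s; rewrite ler_norml; apply/andP; split.
  by apply: stochastic_mul_ge => t; have /ler_normlP[] := uc t; lra.
rewrite -lerN2; have := @stochastic_mul_ge (- u) (- c).
rewrite mulmxN => /(_ _ s); rewrite mxE; apply=> t.
by rewrite mxE; have /ler_normlP[] := uc t; lra.
Qed.

(* At a state minimizing u, the averaged value (Q u) s is at least u s, so
   u s >= g (Q u) s forces (1 - g) u s >= 0. *)
Lemma discounted_min_principle u :
  (forall s, 0 <= (u - g *: (Q *m u)) s ord0) -> forall s, 0 <= u s ord0.
Proof.
move=> hu s.
have [t _ tmin] := @Order.TotalTheory.arg_minP _ K _ s predT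
  (fun i => u i ord0) isT.
apply: le_trans (tmin s isT).
have := @stochastic_mul_ge u (u t ord0) (fun s' => tmin s' isT) t.
have := hu t; rewrite !mxE.
set v := \sum_j _ => uv tv.
have gv : g * u t ord0 <= g * v by rewrite ler_wpM2l.
have : 0 <= (1 - g) * u t ord0 by lra.
by rewrite pmulr_rge0 ?subr_gt0.
Qed.

(** Applied to both [u] and [- u], the minimum principle shows that the kernel is trivial. The
    transposes turn the row-kernel criterion for invertibility into one about columns. *)
Lemma discounted_unitmx : 1%:M - g *: Q \in unitmx.
Proof.
rewrite -unitmx_tr -row_free_unit; apply: inj_row_free => v.
move=> /(congr1 trmx); rewrite trmx_mul trmxK trmx0 => hv.
apply: trmx_inj; rewrite trmx0; move: v^T hv => {v} u.
rewrite mulmxBl mul1mx -scalemxAl => hu.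
apply/matrixP => i j; rewrite [j]ord1 mxE.
have h1 := @discounted_min_principle u.
have h2 := @discounted_min_principle (- u).
apply/eqP; rewrite eq_le; apply/andP; split.
  have := h2 _ i; rewrite mxE oppr_ge0; apply => s.
  by rewrite mulmxN scalerN -opprD hu mxE mxE oppr0.
by apply: h1 => s; rewrite hu mxE.
Qed.

(** The solution [v] of the Bellman equation [v = r + g Q v]. *)
Definition discounted_value (r : 'cV[K]_n) : 'cV[K]_n :=
  invmx (1%:M - g *: Q) *m r.

Lemma discounted_valueE r :
  discounted_value r - g *: (Q *m discounted_value r) = r.
Proof.
rewrite -[X in X - _]mul1mx scalemxAl -mulmxBl /discounted_value mulmxA.
by rewrite mulmxV ?discounted_unitmx ?mul1mx.
Qed.

(** Applying [Q] repeatedly to the Bellman equation makes each summand a difference of consecutive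
    terms, so the Neumann series telescopes with an explicit remainder. *)
Lemma discounted_value_iter r m :
  \sum_(t < m) g ^+ t *: iter t (mulmx Q) r =
  discounted_value r - g ^+ m *: iter m (mulmx Q) (discounted_value r).
Proof.
elim: m => [|m IH]; first by rewrite big_ord0 expr0 scale1r subrr.
rewrite big_ord_recr /= IH.
have -> : iter m (mulmx Q) r = iter m (mulmx Q) (discounted_value r)
          - g *: iter m.+1 (mulmx Q) (discounted_value r).
  rewrite -{1}[r]discounted_valueE; elim: m {IH} => [//|m IH].
  by rewrite !iterS IH mulmxBr -scalemxAr.
by rewrite scalerBr scalerA -exprSr addrA subrK.
Qed.

Lemma iter_stochastic_norm (r : 'cV[K]_n) c m : (forall s, `|r s ord0| <= c) ->
  forall s, `|(iter m (mulmx Q) r) s ord0| <= c.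
Proof. by move=> rc; elim: m => [//|m IH]; exact: stochastic_mul_norm. Qed.

End Stochastic.

(** * Transition matrices averaged over a policy *)

Definition policy_trans (K : realType) nS nA (M : mdp K nS nA)
    (pi : policy K nS nA) : 'M[K]_nS :=
  \matrix_(s, s') \sum_a pi s a * trans M a s s'.

Section PolicyTrans.
Context {K : realType} {nS nA : nat} (M : mdp K nS nA).
Implicit Types pi : policy K nS nA.

Lemma policy_trans_stochastic pi : stochastic (policy_trans M pi).
Proof.
split=> [s s'|s].
  by rewrite mxE sumr_ge0 // => a _; rewrite mulr_ge0 ?policy_ge0 ?trans_ge0.
under eq_bigr do rewrite mxE.
rewrite exchange_big /= -[RHS](policy_sum1 pi s); apply: eq_bigr => a _.
by rewrite -mulr_sumr trans_sum1 mulr1.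
Qed.

(** The chosen action already has mass 1, so the other probabilities are nonnegative with sum 0 and
    all vanish. *)
Lemma deterministic_sum pi (hpi : deterministic pi) s (f : 'I_nA -> K) :
  \sum_a pi s a * f a = f (det_action hpi s).
Proof.
have /eqP p1 := xchooseP (hpi s); rewrite -/(det_action hpi s) in p1.
rewrite (bigD1 (det_action hpi s)) //= p1 mul1r big1 ?addr0 // => a na.
suff -> : pi s a = 0 by rewrite mul0r.
have := policy_sum1 pi s; rewrite (bigD1 (det_action hpi s)) //= p1.
move=> /(congr1 (fun x => x - 1)); rewrite subrr addrAC subrr add0r.
move/eqP; rewrite psumr_eq0 => [|i _]; last exact: policy_ge0.
by move/allP/(_ a (mem_index_enum _)); rewrite na => /eqP.
Qed.

Lemma det_trans_policy_trans pi (hpi : deterministic pi) :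
  det_trans M hpi = policy_trans M pi.
Proof. by apply/matrixP => s s'; rewrite !mxE deterministic_sum. Qed.

Lemma row_det_trans pi (hpi : deterministic pi) s :
  row s (det_trans M hpi) =
  \sum_(a < nA) policy_mx pi s a *: row s (trans M a).
Proof.
rewrite det_trans_policy_trans; apply/rowP => s'.
by rewrite !mxE summxE; apply: eq_bigr => a _; rewrite !mxE.
Qed.

Definition point_policy_fun (f : 'I_nS -> 'I_nA) s a : K := (a == f s)%:R.

Lemma point_policy_ge0 f s a : 0 <= point_policy_fun f s a.
Proof. exact: ler0n. Qed.

Lemma point_policy_sum1 f s : \sum_a point_policy_fun f s a = 1.
Proof.
by rewrite (bigD1 (f s)) //= /point_policy_fun eqxx big1 ?addr0 // => a /negPf->.
Qed.

Definition point_policy (f : 'I_nS -> 'I_nA) : policy K nS nA :=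
  Policy (point_policy_ge0 f) (point_policy_sum1 f).

Lemma point_policy_trans f s s' :
  policy_trans M (point_policy f) s s' = trans M (f s) s s'.
Proof.
rewrite mxE (bigD1 (f s)) //= /point_policy_fun eqxx mul1r big1 ?addr0 // => a.
by move=> /negPf->; rewrite mul0r.
Qed.

End PolicyTrans.

(** * Comparison of the values of two policies *)

Section PolicyImprovement.
Context {K : realType} {nS nA : nat} (M : mdp K nS nA).
Implicit Types pi : policy K nS nA.

Definition policy_value pi :=
  discounted_value (policy_trans M pi) (discount M) (reward M).

(* The reward, and with it the value of [pi'], is eliminated from the right-hand
   side: its sign is governed by the one-step advantages under the value of
   [pi] alone. *)
Lemma policy_value_diff pi pi' :
  let D := policy_value pi - policy_value pi' in
  D - discount M *: (policy_trans M pi' *m D) =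
  discount M *: ((policy_trans M pi - policy_trans M pi') *m policy_value pi).
Proof.
have g0 := ltW (discount_gt0 M); have g1 := discount_lt1 M.
have aux (V W x y z : 'cV[K]_nS) : V - x = W - z -> V - W - (y - z) = x - y.
  move=> /eqP; rewrite subr_eq => /eqP ->.
  by apply/matrixP => i j; rewrite !mxE; ring.
move=> D; rewrite /D mulmxBl mulmxBr !scalerBr; apply: aux.
by rewrite !discounted_valueE //; exact: policy_trans_stochastic.
Qed.

End PolicyImprovement.

(** * Sampling a finite distribution by cutting up the unit interval *)

Section Subdivision.
Context {K : realType} {T : finType} (q : T -> K).
Hypotheses (q_ge0 : forall k, 0 <= q k) (q_sum1 : \sum_k q k = 1).

Definition cumul (m : nat) : K := \sum_(k | (enum_rank k < m)%N) q k.

(** Consecutive half-open intervals tile [[0, 1)], that of [k] having length [q k]; an element of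
    mass zero gets an empty cell. *)
Definition cell (k : T) (u : K) : bool :=
  cumul (enum_rank k) <= u < cumul (enum_rank k).+1.

Lemma cumul0 : cumul 0 = 0. Proof. by rewrite /cumul big_pred0. Qed.

Lemma cumul_card : cumul #|T| = 1.
Proof. by rewrite -q_sum1; apply: eq_bigl => k; exact: ltn_ord. Qed.

Lemma cumul_rankS k : cumul (enum_rank k).+1 = cumul (enum_rank k) + q k.
Proof.
rewrite /cumul (bigD1 k) ?leqnn //= addrC; congr (_ + _).
apply: eq_bigl => j; rewrite ltnS [RHS]ltn_neqAle andbC; congr (_ && _).
by rewrite -(inj_eq enum_rank_inj).
Qed.

Lemma cumul_le m p : (m <= p)%N -> cumul m <= cumul p.
Proof.
move=> mp; rewrite /cumul [leRHS](bigID (fun k => (enum_rank k < m)%N)) /=.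
have -> : \sum_(k | (enum_rank k < p)%N && (enum_rank k < m)%N) q k = cumul m.
  by apply: eq_bigl => k; rewrite andbC; case: ltnP => //= km; rewrite (leq_trans km mp).
by rewrite lerDl sumr_ge0.
Qed.

Lemma cumul_ge0 m : 0 <= cumul m. Proof. by rewrite -cumul0 cumul_le. Qed.

Lemma cumul_rank_le1 k : cumul (enum_rank k) + q k <= 1.
Proof. by rewrite -cumul_rankS -cumul_card cumul_le. Qed.

Lemma cell_inj j k u : cell j u -> cell k u -> j = k.
Proof.
move=> /andP[ju uj] /andP[ku uk]; apply/enum_rank_inj/val_inj/eqP => /=.
rewrite eqn_leq; apply/andP; split; rewrite leqNgt; apply/negP => h.
- by have := lt_le_trans uk (cumul_le h); rewrite ltNge ju.
- by have := lt_le_trans uj (cumul_le h); rewrite ltNge ku.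
Qed.

(** The least [m] with [u < cumul m] exists because [cumul #|T| = 1] and is positive because
    [cumul 0 = 0]; its predecessor is the rank of the required element. *)
Lemma cell_cover u : 0 <= u < 1 -> exists k, cell k u.
Proof.
move=> /andP[u0 u1]; have ex : exists m, u < cumul m.
  by exists #|T|; rewrite cumul_card.
have [[|m] um mmin] := ex_minnP ex; first by rewrite cumul0 ltNge u0 in um.
have mT : (m < #|T|)%N by apply: mmin; rewrite cumul_card.
exists (enum_val (Ordinal mT)); rewrite /cell enum_valK /= um andbT leNgt.
by apply/negP => /mmin; rewrite ltnn.
Qed.

Definition draw (k0 : T) (u : K) : T := odflt k0 [pick k | cell k u].

(** The affine map taking the cell of [k] onto [[0, 1)] when [q k] is positive. *)
Definition rescale (k : T) (u : K) : K := (u - cumul (enum_rank k)) / q k.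

Lemma draw_cell k0 k u : cell k u -> draw k0 u = k.
Proof.
by rewrite /draw; case: pickP => [j /cell_inj /[apply]//|/(_ k)->].
Qed.

Lemma cell_draw k0 u : 0 <= u < 1 -> cell (draw k0 u) u.
Proof. by move=> /cell_cover[k ku]; rewrite (draw_cell k0 ku). Qed.

Lemma cell_itv k u : cell k u -> 0 <= u < 1.
Proof.
move=> /andP[ku]; rewrite cumul_rankS => uk.
by rewrite (le_trans (cumul_ge0 _) ku) (lt_le_trans uk (cumul_rank_le1 k)).
Qed.

Lemma cell_gt0 k u : cell k u -> 0 < q k.
Proof. by move=> /andP[ku]; rewrite cumul_rankS; lra. Qed.

Lemma measurable_draw k0 k : measurable (draw k0 @^-1` [set k]).
Proof.
have mcell j : measurable [set u | cell j u].
  rewrite (_ : [set _ | _] =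
    `[cumul (enum_rank j), cumul (enum_rank j).+1[%classic).
    exact: measurable_itv.
  by apply/seteqP; split => u /=; rewrite in_itv.
(* Outside all cells [draw] returns its default, so the fibre of [k0] also contains the complement
   of their union. *)
have -> : draw k0 @^-1` [set k] = [set u | cell k u] `|`
    (if k == k0 then ~` \bigcup_j [set u | cell j u] else set0).
  apply/seteqP; split => u /=.
    rewrite /draw; case: pickP => [j ju /= <-|nu /= ->]; first by left.
    by right; rewrite eqxx => -[j _ /=]; rewrite nu.
  move=> [/(draw_cell k0)//|]; case: eqP => // -> nu.
  rewrite /draw; case: pickP => // j ju; exfalso; apply: nu.
  by exists j.
apply: measurableU => //; case: ifP => _ //; apply: measurableC.
by apply: fin_bigcup_measurable => //; exact: finite_finset.
Qed.

Lemma measurable_rescale k : measurable_fun setT (rescale k).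
Proof. by apply: measurable_funM => //; apply: measurable_funB. Qed.

End Subdivision.

(** * Simulation of the whole chain from one uniform variable *)

Section Simulation.
Context {K : realType} {St Act : finType} (q : St -> Act * St -> K) (k0 : Act * St).
Hypotheses (q_ge0 : forall s k, 0 <= q s k)
           (q_sum1 : forall s, \sum_k q s k = 1).

(* One uniform variable drives the whole chain: the cell of [u] selects the
   action and next state, and the position of [u] within its cell is again
   uniform and independent of the selection. *)
Fixpoint sim_state (t : nat) (s : St) (u : K) : St :=
  if t is t'.+1 then
    let k := draw (q s) k0 u in sim_state t' k.2 (rescale (q s) k u)
  else s.

Fixpoint sim_action (t : nat) (s : St) (u : K) : Act :=
  let k := draw (q s) k0 u in
  if t is t'.+1 then sim_action t' k.2 (rescale (q s) k u) else k.1.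

(** Splitting over the finitely many values of [draw] leaves one affine map on each piece. This is
    the induction step for the measurability of both simulated processes. *)
Lemma measurable_draw_rescale s (F : Act * St -> set K) :
  (forall k, measurable (F k)) ->
  measurable [set u | F (draw (q s) k0 u) (rescale (q s) (draw (q s) k0 u) u)].
Proof.
move=> mF; rewrite (_ : [set _ | _] = \bigcup_k (draw (q s) k0 @^-1` [set k] `&`
    (rescale (q s) k @^-1` F k))).
  apply: fin_bigcup_measurable => [|k _]; first exact: finite_finset.
  apply: measurableI; first exact: measurable_draw.
  rewrite -[X in measurable X]setTI.
  by apply: (measurable_rescale (q s) k) => //; exact: mF.
apply/seteqP; split => u /=; first by move=> Fu; exists (draw (q s) k0 u).
by move=> [k _ [/= <-]].
Qed.

Lemma measurable_sim_state t s x : measurable (sim_state t s @^-1` [set x]).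
Proof.
elim: t s => [|t IH] s.
  rewrite (_ : _ @^-1` _ = if s == x then setT else set0); first by case: ifP.
  by apply/seteqP; split => u /=; case: eqP.
exact: (@measurable_draw_rescale s (fun k => sim_state t k.2 @^-1` [set x])).
Qed.

Lemma measurable_sim_action t s a : measurable (sim_action t s @^-1` [set a]).
Proof.
elim: t s => [|t IH] s.
  apply: (@measurable_draw_rescale s (fun k => [set _ | k.1 = a])) => k.
  rewrite (_ : [set _ | _] = if k.1 == a then setT else set0).
    by case: ifP.
  by apply/seteqP; split => u /=; case: eqP.
exact: (@measurable_draw_rescale s (fun k => sim_action t k.2 @^-1` [set a])).
Qed.

(** The first step of the path confines [u] to one cell, and [rescale] pulls the interval of the
    remaining path back into that cell, shrunk by the mass of the cell. Lengths therefore multiply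
    to the path probability. *)
Lemma sim_path_itv T s (x : nat -> St) (b : nat -> Act) : x 0%N = s ->
  exists c : K, [/\ 0 <= c,
    c + \prod_(t < T) q (x t) (b t, x t.+1) <= 1 &
    [set u | [/\ 0 <= u < 1, forall t, (t <= T)%N -> sim_state t s u = x t &
                 forall t, (t < T)%N -> sim_action t s u = b t]] =
    `[c, c + \prod_(t < T) q (x t) (b t, x t.+1)[%classic].
Proof.
elim: T s x b => [|T IH] s x b x0.
  exists 0; rewrite big_ord0 add0r; split => //.
  apply/seteqP; split => u /=; rewrite in_itv /=; first by case.
  by move=> u01; split => // t; rewrite leqn0 => /eqP->.
have [c [c_ge0 c_le1 cE]] := IH (x 1%N) (x \o succn) (b \o succn) erefl.
rewrite big_ord_recl /= x0.
set k := (b 0%N, x 1%N); set p := \prod_(_ < T) _ in c_le1 cE.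
have -> : \prod_(i < T) q (x (bump 0 i)) (b (bump 0 i), x (bump 0 i).+1) = p.
  by [].
set m := cumul (q s) (enum_rank k).
have p_ge0 : 0 <= p by apply: prodr_ge0.
have m_ge0 : 0 <= m by exact: cumul_ge0.
have mk_le1 : m + q s k <= 1 by exact: cumul_rank_le1.
have qk := q_ge0 s k.
have qc : 0 <= q s k * c by rewrite mulr_ge0.
have qcp : q s k * (c + p) <= q s k by rewrite ler_piMr.
rewrite mulrDr in qcp.
(* The preimage of [c] under the rescaling of the cell [k], whose left endpoint is [m]. *)
exists (m + q s k * c); split; [by lra|by lra|].
have cellE u : draw (q s) k0 u = k -> 0 <= u < 1 -> cell (q s) k u.
  by move=> <-; exact: cell_draw.
have resc u : 0 < q s k -> (c <= rescale (q s) k u < c + p) =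
    (m + q s k * c <= u < m + q s k * c + q s k * p).
  move=> q0; rewrite /rescale -/m ler_pdivlMr // ltr_pdivrMr //.
  rewrite lerBrDr ltrBlDr mulrDl ![_ * q s k]mulrC.
  by rewrite [_ + m]addrC [_ + m]addrC addrA.
apply/seteqP; split => u /=.
  move=> [u01 hx hb].
  have dk : draw (q s) k0 u = k.
    have := hx 1%N isT; have := hb 0%N isT => /=.
    by case: (draw _ _ _) => a y /= -> ->.
  have ck := cellE u dk u01; have q0 := cell_gt0 ck.
  rewrite in_itv /= -resc //.
  have : [set` `[c, c + p[] (rescale (q s) k u) ; last by rewrite /= in_itv.
  rewrite -cE /=; split.
  - move: ck => /andP[]; rewrite cumul_rankS -/m => mu um.
    rewrite /rescale -/m ler_pdivlMr // ltr_pdivrMr //; lra.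
  - by move=> t tT; have := hx t.+1 tT => /=; rewrite dk.
  - by move=> t tT; have := hb t.+1 tT => /=; rewrite dk.
rewrite in_itv /= => hu.
(* If the cell had mass zero, the interval containing [u] would be empty. *)
have q0 : 0 < q s k.
  rewrite lt_neqAle qk andbT; apply/negP => /eqP q0.
  by move: hu; rewrite -q0 !mul0r; lra.
move: (hu); rewrite -resc // => hr.
have ck : cell (q s) k u.
  by rewrite /cell cumul_rankS -/m; lra.
have dk := draw_cell (q_ge0 s) k0 ck.
have : [set` `[c, c + p[] (rescale (q s) k u) by rewrite /= in_itv.
rewrite -cE => -[_ hx hb]; split.
- exact: (cell_itv (q_ge0 s) (q_sum1 s) ck).
- by move=> [_|t tT] //=; rewrite dk /=; exact: hx.
- by move=> [_|t tT] /=; rewrite dk //=; exact: hb.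
Qed.

End Simulation.

(** * The uniform distribution and the existence of runs *)

(** Kept on the whole line, where the simulation functions are defined, with all its mass on
    [[0, 1)]. *)
Definition unit_interval_prob (K : realType) :
    set (measurableTypeR K) -> \bar K :=
  mrestr (@lebesgue_measure K) (measurable_itv `[0, 1[).

HB.instance Definition _ (K : realType) :=
  Measure.on (@unit_interval_prob K).

Lemma unit_interval_prob_setT (K : realType) :
  @unit_interval_prob K setT = 1%E.
Proof.
rewrite /unit_interval_prob /mrestr setTI lebesgue_measure_itv /=.
by rewrite lte_fin ltr01 oppr0 adde0.
Qed.

HB.instance Definition _ (K : realType) :=
  Measure_isProbability.Build _ _ _ (@unit_interval_prob K)
    (@unit_interval_prob_setT K).

Lemma run_exists (K : realType) nS nA (M : mdp K nS nA) (pi : policy K nS nA) s :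
  exists (d : measure_display) (W : measurableType d)
    (P : probability W K) (X : nat -> W -> 'I_nS) (A : nat -> W -> 'I_nA),
    is_run M pi s P X A.
Proof.
pose q (s : 'I_nS) (k : 'I_nA * 'I_nS) := pi s k.1 * trans M k.1 s k.2.
have q_ge0 r k : 0 <= q r k by rewrite mulr_ge0 ?policy_ge0 ?trans_ge0.
have q_sum1 r : \sum_k q r k = 1.
  rewrite -[RHS](policy_sum1 pi r) -[LHS]/(\sum_k q r (k.1, k.2)).
  rewrite -(pair_bigA _ (fun a y => q r (a, y))) /=.
  apply: eq_bigr => a _.
  by rewrite /q /= -mulr_sumr trans_sum1 mulr1.
(* An action exists because the probabilities at [s] sum to 1; it supplies the default value of
   [draw]. *)
have [a0] : exists a : 'I_nA, True.
  case: (pickP 'I_nA) => [a _|n0]; first by exists a.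
  have := policy_sum1 pi s; rewrite big_pred0 //.
  by move=> /esym/eqP; rewrite oner_eq0.
move=> _; pose k0 := (a0, s).
exists _, (measurableTypeR K), (@unit_interval_prob K),
  (fun t => sim_state q k0 t s), (fun t => sim_action q k0 t s); split.
- by move=> t x; exact: measurable_sim_state.
- by move=> t a; exact: measurable_sim_action.
move=> x b T; rewrite /path_prob.
case: eqP => [x0|nx0]; last first.
  rewrite mul0r (_ : [set _ | _] = set0) ?measure0 //.
  by apply/seteqP; split => u //= -[/(_ 0%N isT)/esym].
have [c [c0 c1 cE]] := @sim_path_itv _ _ _ q k0 q_ge0 q_sum1 T s x b x0.
set D := [set w | _]; rewrite mul1r.
change (lebesgue_measure (D `&` `[0, 1[) =
  (\prod_(t < T) q (x t) (b t, x t.+1))%:E).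
rewrite (_ : _ `&` _ = `[c, c + \prod_(t < T) q (x t) (b t, x t.+1)[%classic).
  rewrite lebesgue_measure_itv /= lte_fin.
  (* In the second case the path has probability zero and its interval is empty. *)
  case: ltP => [_|]; first by rewrite -EFinB addrAC subrr add0r.
  rewrite gerDl => p0; congr (_%:E); apply/esym/eqP; rewrite eq_le p0 /=.
  exact: prodr_ge0.
rewrite -cE; apply/seteqP; split => u /=; rewrite in_itv /=.
  by move=> [[]].
by case.
Qed.

(** * Random variables with finitely many values *)

Section FinitePartition.
Context d (W : measurableType d) (K : realType) (P : probability W K).
Context (I : finType) (Y : W -> I).
Hypothesis mY : forall i, measurable (Y @^-1` [set i]).

Lemma measure_partition (B : set W) : measurable B ->
  P B = (\sum_i P (B `&` Y @^-1` [set i]))%E.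
Proof.
move=> mB; rewrite [in LHS](_ : B = \bigcup_i (B `&` Y @^-1` [set i])).
  rewrite measure_fin_bigcup //; last by move=> i _; exact: measurableI.
  - rewrite (fsbigE (index_enum I)) ?index_enum_uniq // => [|i _].
      by apply: eq_bigl => i; rewrite in_setT.
    by rewrite mem_index_enum.
  - exact: finite_finset.
  - by move=> i j _ _ [w [[_ /= <-] [_ /= <-]]].
by apply/seteqP; split => [w Bw|w [i _ []//]]; exists (Y w).
Qed.

Lemma comp_indicE (f : I -> K) w :
  f (Y w) = \sum_i f i * \1_(Y @^-1` [set i]) w.
Proof.
rewrite (bigD1 (Y w)) //= indicE mem_set // mulr1 big1 ?addr0 // => i ni.
rewrite indicE memNset ?mulr0 //= => yi; by rewrite yi eqxx in ni.
Qed.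

Lemma measurable_comp_fin (f : I -> K) : measurable_fun setT (f \o Y).
Proof.
rewrite (_ : f \o Y = fun w => \sum_i f i * \1_(Y @^-1` [set i]) w).
  by apply: measurable_sum => i; apply: measurable_funM.
by apply/funext => w; exact: comp_indicE.
Qed.

Lemma integrable_comp_fin (f : I -> K) :
  P.-integrable setT (fun w => (f (Y w))%:E).
Proof.
apply: (@le_integrable _ _ _ _ _ _ _ (fun=> (\sum_i `|f i|)%:E)) => //.
- by apply/measurable_EFinP; exact: measurable_comp_fin.
- move=> w _; rewrite lee_fin (le_trans _ (ler_norm _)) //.
  by rewrite (bigD1 (Y w)) //= lerDl sumr_ge0.
- exact: finite_measure_integrable_cst.
Qed.

Lemma integral_comp_fin (f : I -> K) (p : I -> K) :
  (forall i, P (Y @^-1` [set i]) = (p i)%:E) ->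
  (\int[P]_w (f (Y w))%:E = (\sum_i f i * p i)%:E)%E.
Proof.
move=> pE; under eq_integral do rewrite comp_indicE -sumEFin.
have mi i : P.-integrable setT (fun w => (\1_(Y @^-1` [set i]) w)%:E).
  exact: integrable_indic.
rewrite integral_sum //; last first.
  move=> i; under eq_fun do rewrite EFinM.
  exact: integrableZl.
rewrite -sumEFin; apply: eq_bigr => i _.
under eq_integral do rewrite EFinM.
rewrite integralZl // integral_indic // setIT.
by rewrite EFinM; congr (_ * _)%E; exact: pE.
Qed.

End FinitePartition.

(** * The law of the state at a given time of a run *)

Section RunLaw.
Context {K : realType} {nS nA : nat} (M : mdp K nS nA) (pi : policy K nS nA).
Context (s : 'I_nS) d (W : measurableType d) (P : probability W K).
Context (X : nat -> W -> 'I_nS) (A : nat -> W -> 'I_nA).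
Hypothesis runXA : is_run M pi s P X A.
Let Q := policy_trans M pi.

Let mX t x : measurable (X t @^-1` [set x]). Proof. by case: runXA. Qed.
Let mA t a : measurable (A t @^-1` [set a]). Proof. by case: runXA. Qed.

Definition cylinder (x : nat -> 'I_nS) (b : nat -> 'I_nA) T : set W :=
  [set w | (forall t, (t <= T)%N -> X t w = x t) /\
           (forall t, (t < T)%N -> A t w = b t)].

Lemma measurable_cylinder x b T : measurable (cylinder x b T).
Proof.
rewrite (_ : cylinder x b T =
  \bigcap_(t in `I_T.+1) (X t @^-1` [set x t]) `&`
  \bigcap_(t in `I_T) (A t @^-1` [set b t])) //.
by apply: measurableI; apply: bigcap_measurableType => t _.
Qed.

(** The Markov property, by induction on the remaining time [n]: splitting over the next action and
    state extends the cylinder by one step, and summing over them produces one more factor [Q]. *)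
Lemma run_law_from (y : 'I_nS) n k x b :
  P (cylinder x b k `&` X (n + k) @^-1` [set y]) =
  (path_prob M pi s x b k * (iter n (mulmx Q) (delta_mx y ord0 : 'cV[K]_nS)) (x k) ord0)%:E.
Proof.
have [_ _ hP] := runXA.
elim: n k x b => [|n IH] k x b.
  rewrite add0n /= mxE eqxx andbT.
  case: eqP => [xy|nxy].
    rewrite mulr1 -hP; congr (P _); apply/seteqP; split => w; first by case.
    by move=> cw; split => //=; rewrite cw.1.
  rewrite mulr0 (_ : _ `&` _ = set0) ?measure0 //; apply/seteqP; split => // w.
  by move=> [[hx _] /= yw]; apply: nxy; rewrite -hx.
pose Y w := (A k w, X k.+1 w).
have mY i : measurable (Y @^-1` [set i]).
  case: i => a z; rewrite (_ : _ @^-1` _ = A k @^-1` [set a] `&` X k.+1 @^-1` [set z]).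
    exact: measurableI.
  by apply/seteqP; split => w /=; rewrite /Y; [case|move=> [-> ->]].
rewrite (measure_partition P mY); last first.
  by apply: measurableI => //; exact: measurable_cylinder.
(* Overriding the state at [k.+1] and the action at [k] appends the step [(a, z)] to the path. *)
pose x' z t := if t == k.+1 then z else x t.
pose b' a t := if t == k then a else b t.
have cylE a z : cylinder x b k `&` X (n.+1 + k) @^-1` [set y] `&` Y @^-1` [set (a, z)] =
    cylinder (x' z) (b' a) k.+1 `&` X (n + k.+1) @^-1` [set y].
  rewrite addSnnS; apply/seteqP; split => w /=.
    move=> [[[hx hb] hy] [ha hz]]; split => //; split => t.
      rewrite leq_eqVlt /x'; case: eqP => [->//|_ /=]; rewrite ltnS; exact: hx.
    rewrite ltnS leq_eqVlt /b'; case: eqP => [->//|_ /=]; exact: hb.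
  move=> [[hx hb] hy]; split; [split => //; split => t tk|].
  - by rewrite hx ?(leqW tk) // /x' ltn_eqF.
  - by rewrite hb ?ltnS ?(ltnW tk) // /b' ltn_eqF.
  - by rewrite /Y hx // hb // /x' /b' !eqxx.
have pathE a z : path_prob M pi s (x' z) (b' a) k.+1 =
    path_prob M pi s x b k * (pi (x k) a * trans M a (x k) z).
  rewrite /path_prob big_ord_recr /= mulrA /b' /x' !eqxx (ltn_eqF (ltnSn k)).
  congr (_ * _ * _); apply: eq_bigr => t _.
  by rewrite eqSS (ltn_eqF (ltn_ord t)) (ltn_eqF (leqW (ltn_ord t))).
rewrite (eq_bigr (fun az => (path_prob M pi s x b k *
  (pi (x k) az.1 * trans M az.1 (x k) az.2 *
   (iter n (mulmx Q) (delta_mx y ord0 : 'cV[K]_nS)) az.2 ord0))%:E)); last first.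
  by move=> [a z] _; rewrite cylE IH pathE /x' eqxx -!mulrA.
rewrite sumEFin -mulr_sumr; congr (_ * _)%:E; rewrite iterS mxE.
under [RHS]eq_bigr do rewrite mxE mulr_suml.
by rewrite exchange_big pair_bigA.
Qed.

Lemma run_law n y : P (X n @^-1` [set y]) =
  ((iter n (mulmx Q) (delta_mx y ord0 : 'cV[K]_nS)) s ord0)%:E.
Proof.
have [_ _ hP] := runXA.
(* A cylinder of length 0 constrains no action, but naming it takes some action sequence. *)
have [b _] : exists b : nat -> 'I_nA, True.
  have [a _|n0] := pickP 'I_nA; first by exists (fun=> a).
  have := policy_sum1 pi s; rewrite big_pred0 // => /esym/eqP.
  by rewrite oner_eq0.
rewrite (measure_partition P (mX 0)) //.
rewrite (eq_bigr (fun z => ((z == s)%:R *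
    (iter n (mulmx Q) (delta_mx y ord0 : 'cV[K]_nS)) z ord0)%:E)) => [|z _].
  rewrite sumEFin (bigD1 s) //= eqxx mul1r big1 ?addr0 // => z /negPf->.
  by rewrite mul0r.
have := run_law_from y n 0 (fun=> z) b.
rewrite /path_prob big_ord0 mulr1 addn0 => <-; congr (P _).
rewrite setIC; congr (_ `&` _); apply/seteqP; split => w /=.
  by move=> h; split => // t; rewrite leqn0 => /eqP->.
by case=> + _; apply.
Qed.

Lemma run_expectation n (f : 'cV[K]_nS) :
  (\int[P]_w (f (X n w) ord0)%:E = ((iter n (mulmx Q) f) s ord0)%:E)%E.
Proof.
rewrite (integral_comp_fin (mX n) (fun i => f i ord0) (run_law n)).
(* Expanding [f] in unit columns reduces the claim to linearity of the iterated product. The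
   induction on [n] generalizes the start state, since [Q] mixes the rows. *)
have {2}-> : f = \sum_i f i ord0 *: delta_mx i ord0.
  apply/matrixP => i j; rewrite [j]ord1 summxE (bigD1 i) //= !mxE !eqxx mulr1.
  rewrite big1 ?addr0 // => k ki; rewrite !mxE eq_sym (negPf ki) mulr0 //.
congr (_%:E); elim: n s => [|n IH] r.
  by rewrite /= summxE; apply: eq_bigr => i _; rewrite [RHS]mxE.
rewrite iterS mxE; under [RHS]eq_bigr do rewrite -IH mulr_sumr.
rewrite exchange_big; apply: eq_bigr => i _; rewrite iterS mxE mulr_sumr.
by apply: eq_bigr => j _; rewrite mulrCA.
Qed.

End RunLaw.

(** * The expected discounted return *)

Section Value.
Context {K : realType} {nS nA : nat} (M : mdp K nS nA) (pi : policy K nS nA).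
Let g := discount M.
Let g0 : 0 <= g. Proof. exact: ltW (discount_gt0 M). Qed.
Let g1 : g < 1. Proof. exact: discount_lt1 M. Qed.
Let stoQ := policy_trans_stochastic M pi.

(** The iterates of a stochastic matrix stay bounded by [B], so the remainder is squeezed between
    multiples of [g ^+ n]. *)
Lemma discounted_remainder_cvg (v : 'cV[K]_nS) s :
  ((v - g ^+ n *: iter n (mulmx (policy_trans M pi)) v) s ord0) @[n --> \oo]
    --> v s ord0.
Proof.
pose B := \sum_z `|v z ord0|.
have vB z : `|v z ord0| <= B by rewrite /B (bigD1 z) //= lerDl sumr_ge0.
have gB0 (c : K) : v s ord0 + g ^+ n * c @[n --> \oo] --> v s ord0.
  rewrite -[X in _ --> X]addr0 -[X in _ + X](mul0r c).
  apply: cvgD; first exact: cvg_cst.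
  by apply: cvgMr_tmp; apply: cvg_expr; rewrite ger0_norm.
apply: (squeeze_cvgr _ (gB0 (- B)) (gB0 B)); apply: nearW => n.
have /ler_normlP[h1 h2] := iter_stochastic_norm stoQ n vB s.
rewrite !mxE -mulrN !lerD2l.
by apply/andP; split; rewrite ler_wpM2l ?exprn_ge0 //; lra.
Qed.

(** The telescoped sum gives the expectation of each partial return; the sum [L] of a geometric
    series bounds them all, and dominated convergence passes to the limit. *)
Lemma run_value s d (W : measurableType d) (P : probability W K)
    (X : nat -> W -> 'I_nS) (A : nat -> W -> 'I_nA) :
  is_run M pi s P X A ->
  'E_P[discounted_return M X]%E = (policy_value M pi s ord0)%:E.
Proof.
move=> runXA; have [mX _ _] := runXA.
pose C := \sum_z `|reward M z ord0|.
have rC z : `|reward M z ord0| <= C.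
  by rewrite /C (bigD1 z) //= lerDl sumr_ge0.
have C0 : 0 <= C by rewrite sumr_ge0.
pose u w t := g ^+ t * reward M (X t w) ord0.
have gnorm : `|g| < 1 by rewrite ger0_norm.
have le_geo w t : `|u w t| <= geometric C g t.
  by rewrite /u normrM ger0_norm ?exprn_ge0 //= mulrC ler_wpM2r ?exprn_ge0.
(* Absolute convergence makes the [limn] in [discounted_return] a genuine limit at every [w]. *)
have ucvg w : series (u w) @ \oo --> discounted_return M X w.
  apply: normed_cvg; apply: (series_le_cvg _ _ (le_geo w)) => [t|t|].
  - exact: normr_ge0.
  - by rewrite /= mulr_ge0 ?exprn_ge0.
  - exact: is_cvg_geometric_series.
pose L := limn (series (geometric C g)).
have geo_le n : series (geometric C g) n <= L.
  apply: nondecreasing_cvgn_le; last exact: is_cvg_geometric_series.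
  by apply: nondecreasing_series => t _ _; rewrite /= mulr_ge0 ?exprn_ge0.
have bound n w : `|series (u w) n| <= L.
  apply: le_trans (geo_le n); apply: le_trans (ler_norm_sum _ _ _) _.
  by apply: ler_sum => t _; exact: le_geo.
have mu n : measurable_fun setT (fun w => (series (u w) n)%:E).
  apply/measurable_EFinP; rewrite /series /=; apply: measurable_sum => t.
  apply: measurable_funM => //.
  exact: (measurable_comp_fin (mX t) (fun z => reward M z ord0)).
have intE n : (\int[P]_w (series (u w) n)%:E =
   ((policy_value M pi - g ^+ n *: iter n (mulmx (policy_trans M pi))
      (policy_value M pi)) s ord0)%:E)%E.
  rewrite -discounted_value_iter //.
  under eq_integral do rewrite /series /= big_mkord -sumEFin.
  rewrite integral_sum //; last first.
    move=> t; under eq_fun do rewrite EFinM; apply: integrableZl => //.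
    exact: (integrable_comp_fin P (mX t) (fun z => reward M z ord0)).
  rewrite summxE -sumEFin; apply: eq_bigr => t _; rewrite mxE EFinM.
  rewrite -(run_expectation runXA).
  under eq_integral do rewrite EFinM.
  rewrite integralZl //.
  exact: (integrable_comp_fin P (mX t) (fun z => reward M z ord0)).
have limV : (fun n => \int[P]_w (series (u w) n)%:E)%E @ \oo
    --> (policy_value M pi s ord0)%:E.
  rewrite (funext intE); apply: cvg_EFin; first exact: nearW.
  exact: discounted_remainder_cvg.
rewrite unlock; apply: (cvg_unique _ _ limV) => //.
apply: (@dominated_cvg _ _ _ P setT measurableT _ _ (fun=> L%:E)) => //.
- move=> w _; apply: cvg_EFin; [exact: nearW|exact: ucvg].
- exact: finite_measure_integrable_cst.
- by move=> n w _; rewrite lee_fin; exact: bound.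
Qed.

(** [run_exists] makes the defining set nonempty and [run_value] leaves it a single element, so
    [xget] never falls back on 0. *)
Lemma valueE s : value M pi s = policy_value M pi s ord0.
Proof.
rewrite /value; set E := [set v | _].
have [d [W [P [X [A runXA]]]]] := run_exists M pi s.
have : E (policy_value M pi s ord0).
  by exists d, W, P, X, A; split => //; exact: run_value runXA.
move=> /(xgetI 0) [d' [W' [P' [X' [A' [run']]]]]].
by rewrite (run_value run') => -[].
Qed.

End Value.

(** * The optimality criterion *)

Theorem theorem1 (K : realType) (nS nA : nat) (M : mdp K nS nA)
    (pi : policy K nS nA) (hpi : deterministic pi) :
  optimal M pi <->
  (forall (a : 'I_nA) (s : 'I_nS),
      0 <= ((det_trans M hpi - trans M a)
              *m invmx (1%:M - discount M *: det_trans M hpi)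
              *m reward M) s ord0) /\
  (forall s : 'I_nS,
      row s (det_trans M hpi)
      = \sum_(a < nA) policy_mx pi s a *: row s (trans M a)).
Proof.
have g_gt0 := discount_gt0 M; have g_lt1 := discount_lt1 M.
have g_ge0 := ltW g_gt0.
set V := policy_value M pi.
have advE a s : ((det_trans M hpi - trans M a)
    *m invmx (1%:M - discount M *: det_trans M hpi) *m reward M) s ord0 =
    (policy_trans M pi *m V) s ord0 - (trans M a *m V) s ord0.
  by rewrite det_trans_policy_trans -mulmxA mulmxBl mxE [X in _ + X]mxE.
split=> [opt|[adv _]]; last first.
  move=> pi' s; rewrite !valueE -subr_ge0.
  have sto' := policy_trans_stochastic M pi'.
  suff : 0 <= (V - policy_value M pi') s ord0 by rewrite !mxE.
  apply: (discounted_min_principle sto' g_ge0 g_lt1) => {}s.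
  rewrite policy_value_diff mxE mulr_ge0 // mulmxBl mxE [X in _ + X]mxE -/V.
  have -> : (policy_trans M pi' *m V) s ord0 =
      \sum_a pi' s a * (trans M a *m V) s ord0.
    rewrite mxE; under eq_bigr do rewrite mxE mulr_suml.
    rewrite exchange_big; apply: eq_bigr => a _.
    by rewrite mxE mulr_sumr; apply: eq_bigr => j _; rewrite mulrA.
  (* Writing the first term as its own average under [pi' s] makes the difference an average of the
     assumed inequalities. *)
  rewrite -[X in 0 <= X - _]mul1r -(policy_sum1 pi' s) mulr_suml -sumrB.
  apply: sumr_ge0 => a _; rewrite -mulrBr mulr_ge0 ?policy_ge0 //.
  by rewrite -advE.
split=> [a s|s]; last exact: row_det_trans.
rewrite advE leNgt subr_lt0; apply/negP => adv_lt0.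
(* The deviation from [pi] at the single state [s] where the inequality fails. *)
pose f r := if r == s then a else det_action hpi r.
pose pi' : policy K nS nA := point_policy f.
have sto' := policy_trans_stochastic M pi'.
pose D := V - policy_value M pi'.
have DE r : (D - discount M *: (policy_trans M pi' *m D)) r ord0 =
    discount M * ((policy_trans M pi *m V) r ord0 - (trans M (f r) *m V) r ord0).
  rewrite policy_value_diff mxE mulmxBl mxE [X in _ + X]mxE -/V.
  congr (_ * (_ - _)); rewrite mxE [RHS]mxE.
  by apply: eq_bigr => j _; rewrite point_policy_trans.
(* The right-hand side of [DE] is negative at [s] and zero elsewhere, where [f] plays the action of
   [pi]; the minimum principle applies to [- D]. *)
have D_le0 r : 0 <= (- D) r ord0.
  apply: (discounted_min_principle sto' g_ge0 g_lt1) => {}r.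
  rewrite mulmxN scalerN -opprD mxE DE -mulrN mulr_ge0 // opprB subr_ge0 /f.
  case: eqP => [->|_]; first exact: ltW.
  rewrite -(det_trans_policy_trans M hpi) !mxE.
  by apply: ler_sum => j _; rewrite !mxE.
(* Optimality of [pi] supplies the opposite inequality. *)
have D0 : D = 0.
  apply/matrixP => r j; rewrite [j]ord1 [RHS]mxE; apply/eqP.
  rewrite eq_le -oppr_ge0; have := D_le0 r; rewrite mxE => -> /=.
  by have := opt pi' r; rewrite !valueE -subr_ge0 /D !mxE.
(* At [s], [DE] now equates 0 with a positive discount times a negative number. *)
have := DE s; rewrite D0 mulmx0 scaler0 subr0 mxE /f eqxx => /esym/eqP.
by rewrite mulf_eq0 (gt_eqF g_gt0) subr_eq0 (lt_eqF adv_lt0).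
Qed.
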